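(* Consider smooth fields on a neighborhood of the origin in $\mathbb{R}^3$ describing a steady state of one fluid species in a rotationally symmetric two-dimensional problem: number density $n>0$, temperature $T>0$, scalar pressure $p=nT$, fluid velocity $\mathbf{u}$, heat flux vector $\mathbf{q}$, a scalar field $\mathrm{error}$, a scalar $\tau>0$ (relaxation period), and a fourth-order tensor field $\tilde\mu$ of (gyrotropic) viscosity coefficients mapping symmetric traceless tensors to symmetric traceless tensors. Let $s=\ln(T^{3/2}/n)$, let $e^\circ=\mathrm{Sym}(\nabla\mathbf{u})-\tfrac13 I\,\nabla\cdot\mathbf{u}$ be the deviatoric strain rate, and let the pressure tensor be $P=p(I+\pi^\circ)$ with $\pi^\circ$ symmetric and traceless. Assume that in a neighborhood of the origin mass is conserved in steady state, $\nabla\cdot(n\mathbf{u})=0$, that the steady five-moment entropy evolution equation $$\mathbf{u}\cdot\nabla s=-e^\circ:(I+\pi^\circ)-p^{-1}\,\nabla\cdot\mathbf{q}+\mathrm{error}$$ holds, and that the stress closure $$-\pi^\circ=2\tau\,\tilde\mu:e^\circ$$ holds, where the coefficients satisfy, at each point, $A:\tilde\mu:A>0$ for every symmetric traceless second-order tensor $A\neq0$. Suppose that $\nabla\cdot\mathbf{q}$, $\nabla^2(\nabla\cdot\mathbf{q})$, $\mathrm{error}$, $\nabla\,\mathrm{error}$ and $\nabla\nabla\,\mathrm{error}$ all vanish at the origin. Then $\nabla\cdot P=0$ at the origin.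
   Context: Coordinates are $(x,y,z)$. A problem is two-dimensional if all fields are independent of $z$ ($\partial_z=0$). It is rotationally symmetric if it is invariant under $180^\circ$ rotation about the $z$-axis: every component of every tensor field with an odd number of indices in $\{x,y\}$ is an odd function under $(x,y)\mapsto(-x,-y)$, and every component with an even number of such indices is an even function (scalars are even). Notation: $\mathrm{Sym}$ is the symmetric part of a tensor; $(\nabla\mathbf{u})_{ij}=\partial_i u_j$; $A:B=\sum_{ij}A_{ij}B_{ij}$; $(\tilde\mu:A)_{ij}=\sum_{kl}\tilde\mu_{ijkl}A_{kl}$ and $A:\tilde\mu:A=\sum_{ijkl}A_{ij}\tilde\mu_{ijkl}A_{kl}$; $(\nabla\cdot P)_j=\sum_i\partial_iP_{ij}$; $\nabla^2$ is the Laplacian; $I$ is the identity tensor. ''Gyrotropic'' means invariant under rotations about the direction of the magnetic field. *)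

(* Defs.v *)
From HB Require Import structures.
From mathcomp Require Import all_boot all_order all_algebra.
From mathcomp Require Import all_classical all_reals all_analysis.
Set Implicit Arguments.
Unset Strict Implicit.
Unset Printing Implicit Defensive.
Import Order.TTheory GRing.Theory Num.Theory.
Import numFieldNormedType.Exports.
Local Open Scope classical_set_scope.
Local Open Scope ring_scope.

(* Points of R^3 are row vectors; the coordinates x, y, z have the indices
   0, 1, 2 : 'I_3, so that ord_max is the index of z. *)

Section VectorCalculus.
Variable R : realType.
Implicit Types (U : set 'rV[R]_3) (f : 'rV[R]_3 -> R).

Definition partial (i : 'I_3) f : 'rV[R]_3 -> R :=
  fun x => 'D_(delta_mx 0 i) f x.

(* All iterated partial derivatives up to order k exist and are continuous
   at every point of U (meant for open U). *)
Fixpoint Ck (k : nat) U f : Prop :=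
  (forall x, U x -> {for x, continuous f}) /\
  (if k is k'.+1 then
     forall i : 'I_3,
       (forall x, U x -> derivable f x (delta_mx 0 i)) /\ Ck k' U (partial i f)
   else True).

Definition smooth U f : Prop := forall k, Ck k U f.

Definition grad f : 'rV[R]_3 -> 'rV[R]_3 := fun x => \row_i partial i f x.

Definition hess f : 'rV[R]_3 -> 'M[R]_3 :=
  fun x => \matrix_(i, j) partial i (partial j f) x.

Definition laplacian f : 'rV[R]_3 -> R :=
  fun x => \sum_(i < 3) partial i (partial i f) x.

Definition div_vec (u : 'rV[R]_3 -> 'rV[R]_3) : 'rV[R]_3 -> R :=
  fun x => \sum_(i < 3) partial i (fun y => u y 0 i) x.

Definition grad_vec (u : 'rV[R]_3 -> 'rV[R]_3) : 'rV[R]_3 -> 'M[R]_3 :=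
  fun x => \matrix_(i, j) partial i (fun y => u y 0 j) x.

Definition div_tensor (P : 'rV[R]_3 -> 'M[R]_3) : 'rV[R]_3 -> 'rV[R]_3 :=
  fun x => \row_j \sum_(i < 3) partial i (fun y => P y i j) x.

End VectorCalculus.

Section Tensors.
Variable R : realType.

Definition tensor4 := 'I_3 -> 'I_3 -> 'I_3 -> 'I_3 -> R.

Definition dot (u v : 'rV[R]_3) : R := \sum_(i < 3) u 0 i * v 0 i.

Definition ddot (A B : 'M[R]_3) : R :=
  \sum_(i < 3) \sum_(j < 3) A i j * B i j.

Definition sym_part (A : 'M[R]_3) : 'M[R]_3 := 2^-1 *: (A + A^T).

Definition sym_traceless (A : 'M[R]_3) : Prop := A^T = A /\ \tr A = 0.

Definition contract4 (mu : tensor4) (A : 'M[R]_3) : 'M[R]_3 :=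
  \matrix_(i, j) \sum_(k < 3) \sum_(l < 3) mu i j k l * A k l.

Definition quad4 (mu : tensor4) (A : 'M[R]_3) : R :=
  \sum_(i < 3) \sum_(j < 3) \sum_(k < 3) \sum_(l < 3)
    A i j * mu i j k l * A k l.

(* The rotation v |-> v *m Q of row vectors acts on fourth-order tensors by
   one factor of Q per index. *)
Definition rotate4 (Q : 'M[R]_3) (mu : tensor4) : tensor4 :=
  fun i j k l =>
    \sum_(a < 3) \sum_(b < 3) \sum_(c < 3) \sum_(d < 3)
      mu a b c d * Q a i * Q b j * Q c k * Q d l.

Definition rotation (Q : 'M[R]_3) : Prop := Q *m Q^T = 1%:M /\ \det Q = 1.

(* Invariance under the rotations about the direction of B; where B = 0 there
   is no such direction and nothing is required. *)
Definition gyrotropic (B : 'rV[R]_3) (mu : tensor4) : Prop :=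
  B <> 0 ->
  forall Q : 'M[R]_3, rotation Q -> B *m Q = B ->
  forall i j k l, rotate4 Q mu i j k l = mu i j k l.

End Tensors.

Section Symmetry.
Variable R : realType.
Implicit Types (U : set 'rV[R]_3) (f : 'rV[R]_3 -> R).

Definition rot180 (x : 'rV[R]_3) : 'rV[R]_3 :=
  \row_i (if i == ord_max then x 0 i else - x 0 i).

Definition two_dimensional U f : Prop :=
  forall x, U x -> partial ord_max f x = 0.

(* f is the component with index list idx of a tensor field; the sign is the
   parity of the number of indices in {x, y}. U need not be invariant under
   rot180: only pairs of points of U are compared. *)
Definition rot_symmetric U (idx : seq 'I_3) f : Prop :=
  forall x, U x -> U (rot180 x) ->
    f (rot180 x) = (-1) ^+ count (fun i => i != ord_max) idx * f x.

Definition admissible_component U (idx : seq 'I_3) f : Prop :=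
  [/\ smooth U f, two_dimensional U f & rot_symmetric U idx f].

Definition admissible_scalar U f : Prop := admissible_component U [::] f.

Definition admissible_vector U (u : 'rV[R]_3 -> 'rV[R]_3) : Prop :=
  forall i, admissible_component U [:: i] (fun x => u x 0 i).

Definition admissible_tensor2 U (A : 'rV[R]_3 -> 'M[R]_3) : Prop :=
  forall i j, admissible_component U [:: i; j] (fun x => A x i j).

Definition admissible_tensor4 U (mu : 'rV[R]_3 -> tensor4 R) : Prop :=
  forall i j k l,
    admissible_component U [:: i; j; k; l] (fun x => mu x i j k l).

End Symmetry.

Section Fluid.
Variable R : realType.
Implicit Types (n T : 'rV[R]_3 -> R) (u : 'rV[R]_3 -> 'rV[R]_3).

Definition pressure n T : 'rV[R]_3 -> R := fun x => n x * T x.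

Definition entropy n T : 'rV[R]_3 -> R :=
  fun x => ln (T x `^ (3 / 2) / n x).

Definition dev_strain u : 'rV[R]_3 -> 'M[R]_3 :=
  fun x => sym_part (grad_vec u x) - (3^-1 * div_vec u x)%:M.

Definition pressure_tensor n T (dev : 'rV[R]_3 -> 'M[R]_3) :
    'rV[R]_3 -> 'M[R]_3 :=
  fun x => pressure n T x *: (1%:M + dev x).

End Fluid.

(* Main.v *)
(** By symmetry the scalars have zero gradient at the origin and the in-plane
    velocity vanishes there, so mass conservation gives div u = 0 and the entropy
    equation reduces at the origin to e : mu : e = 0, where e is the deviatoric
    strain rate; hence e = 0 and the velocity gradient is skew-symmetric.
    Take the Laplacian of the entropy equation at the origin. The transport term
    contributes 2 grad u : hess s, a skew-symmetric tensor against a symmetric one,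
    and the heat flux and error terms vanish by assumption, so what remains is
    sum_m (d_m e) : mu : (d_m e) = 0. Hence every d_m e vanishes at the origin, by the
    closure so does every d_m pi, and therefore div P = 0. *)
Require Import Defs.
From HB Require Import structures.
From mathcomp Require Import all_boot all_order all_algebra.
From mathcomp Require Import all_classical all_reals all_analysis.
From mathcomp Require Import ring lra.
Set Implicit Arguments.
Unset Strict Implicit.
Import Order.TTheory GRing.Theory Num.Theory.
Import numFieldNormedType.Exports.
Local Open Scope classical_set_scope.
Local Open Scope ring_scope.

(** * Directional derivatives: restriction to lines, chain rule, symmetry of mixed derivatives *)

Section DirectionalDerivatives.
Context {R : realType} {V : normedModType R}.
Implicit Types (f g : V -> R) (x v w : V) (U : set V).

(** Both sides have literally the same difference quotient as a function of the increment; this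
    transfers one-variable calculus to directional derivatives. *)
Lemma is_derive_line f x v (t : R) : derivable f (x + t *: v) v ->
  is_derive t 1 (fun s : R => f (x + s *: v)) ('D_v f (x + t *: v)).
Proof.
have E : (fun h : R => h^-1 *: (((fun s : R => f (x + s *: v)) \o shift t) (h *: 1)
            - f (x + t *: v))) =
         (fun h : R => h^-1 *: ((f \o shift (x + t *: v)) (h *: v) - f (x + t *: v))).
  apply/funext => h /=.
  by rewrite [h *: 1]mulr1 scalerDl addrCA.
by move=> df; split; rewrite /derivable /derive E.
Qed.

Lemma is_derive_line0 f x v d :
  is_derive (0 : R) 1 (fun s : R => f (x + s *: v)) d -> is_derive x v f d.
Proof.
have E : (fun h : R => h^-1 *: (((fun s : R => f (x + s *: v)) \o shift 0) (h *: 1)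
            - f (x + 0 *: v))) =
         (fun h : R => h^-1 *: ((f \o shift x) (h *: v) - f x)).
  apply/funext => h /=.
  by rewrite [h *: 1]mulr1 addr0 scale0r addr0 [x + _]addrC.
by case=> df d_val; split; move: df d_val; rewrite /derivable /derive E.
Qed.

(** The one-variable chain rule on the line through [x]; derivability of [f] along [v] alone
    suffices. *)
Lemma is_derive_comp (phi : R -> R) f x v (a b : R) :
  is_derive (f x) 1 phi a -> is_derive x v f b ->
  is_derive x v (phi \o f) (a * b).
Proof.
move=> dphi [df <-]; apply: is_derive_line0.
apply: (@is_derive1_comp _ phi (fun s : R => f (x + s *: v))).
  by rewrite scale0r addr0.
have := @is_derive_line f x v 0; rewrite scale0r addr0; exact.
Qed.

Lemma MVT_line f x v (h : R) : 0 <= h ->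
  (forall t, 0 <= t <= h -> derivable f (x + t *: v) v) ->
  exists2 t, 0 <= t <= h & f (x + h *: v) - f x = h * 'D_v f (x + t *: v).
Proof.
move=> h0 df.
have dl t : 0 <= t <= h ->
    is_derive t 1 (fun s : R => f (x + s *: v)) ('D_v f (x + t *: v)).
  by move=> /df; exact: is_derive_line.
have [t||t] := MVT_segment h0 (f := fun s : R => f (x + s *: v))
    (df := fun t => 'D_v f (x + t *: v)).
- by rewrite in_itv/= => /andP[/ltW ? /ltW ?]; apply: dl; apply/andP.
- apply: derivable_within_continuous => t; rewrite in_itv/= => th.
  by case: (dl t th).
rewrite in_itv/= scale0r addr0 subr0 mulrC => th ->; by exists t.
Qed.

(** The double difference is the increment along [v] of [g y = f (y + h *: w) - f y]. The mean value
    theorem for [g] along [v] gives a difference of values of ['D_v f], and a second application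
    along [w] finishes. *)
Lemma double_difference f x v w (h : R) : 0 <= h ->
  (forall s t, 0 <= s <= h -> 0 <= t <= h ->
    derivable f (x + s *: v + t *: w) v /\
    derivable ('D_v f) (x + s *: v + t *: w) w) ->
  exists s t, [/\ 0 <= s <= h, 0 <= t <= h &
    f (x + h *: v + h *: w) - f (x + h *: v) - f (x + h *: w) + f x =
    h * h * 'D_w ('D_v f) (x + s *: v + t *: w)].
Proof.
move=> h0 df.
have h00 : 0 <= (0 : R) <= h by apply/andP.
have hh : 0 <= h <= h by apply/andP.
pose g y := f (y + h *: w) - f y.
have dshift s : 0 <= s <= h ->
    is_derive (x + s *: v) v (fun y => f (y + h *: w)) ('D_v f (x + s *: v + h *: w)).
  move=> sh; apply: is_derive_line0; have [ds _] := df s h sh hh.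
  have := @is_derive_line f (x + s *: v + h *: w) v 0; rewrite scale0r addr0 => /(_ ds).
  congr (is_derive _ _ _ _); apply/funext => t; congr f; rewrite addrAC //.
have dg s : 0 <= s <= h ->
    is_derive (x + s *: v) v g ('D_v f (x + s *: v + h *: w) - 'D_v f (x + s *: v)).
  move=> sh; apply: is_deriveB; first exact: dshift.
  apply: derivableP; have := (df s 0 sh h00).1; by rewrite scale0r addr0.
have [s sh Es] := @MVT_line g x v h h0 (fun s sh => ex_derive (is_derive := dg s sh)).
have [t th Et] := @MVT_line ('D_v f) (x + s *: v) w h h0
  (fun t th => (df s t sh th).2).
exists s, t; split=> //.
rewrite -mulrA -Et -(derive_val (is_derive := dg s sh)) -Es /g; ring.
Qed.

(* Schwarz: both mixed derivatives are limits of the same double difference quotient. *)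
Lemma derive_comm U f x v w : open U -> U x ->
  (forall y, U y -> derivable f y v) -> (forall y, U y -> derivable f y w) ->
  (forall y, U y -> derivable ('D_v f) y w) ->
  (forall y, U y -> derivable ('D_w f) y v) ->
  {for x, continuous ('D_w ('D_v f))} -> {for x, continuous ('D_v ('D_w f))} ->
  'D_w ('D_v f) x = 'D_v ('D_w f) x.
Proof.
move=> oU Ux dv dw dvw dwv cvw cwv.
apply/eqP; rewrite -subr_eq0 -normr_le0; apply/ler_addgt0Pr => e e0; rewrite add0r.
have e20 : 0 < e / 2 by rewrite divr_gt0.
have F := nbhs_filter x.
have N1 := open_nbhs_nbhs (conj oU Ux).
have N2 := (@cvgrPdist_lt _ _ _ _ F _ _).1 cvw _ e20.
have N3 := (@cvgrPdist_lt _ _ _ _ F _ _).1 cwv _ e20.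
have N4 := @filterI _ _ F _ _ N1 (@filterI _ _ F _ _ N2 N3).
have [r /= r0 rP] := (nbhs_ballP _ _).1 N4.
(* The summand 1 keeps [K] positive when [v] and [w] are both zero. Since [h * K = r / 2], every
   displacement [s *: v + t *: w] with [s] and [t] at most [h] has norm below [r]. *)
set K := `|v| + `|w| + 1.
have K0 : 0 < K by rewrite ltr_wpDl// addr_ge0.
pose h := r / 2 / K.
have h0 : 0 < h by rewrite !divr_gt0.
have inball s t : 0 <= s <= h -> 0 <= t <= h -> ball x r (x + s *: v + t *: w).
  move=> /andP[s0 sh] /andP[t0 th]; rewrite -ball_normE /= opprD opprD addrA addrA subrr add0r.
  rewrite -opprD normrN (le_lt_trans (ler_normD _ _))//.
  rewrite !normrZ !ger0_norm//.
  have hK : h * K = r / 2 by rewrite /h divfK// gt_eqF.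
  have sv : s * `|v| <= h * `|v| by rewrite ler_wpM2r.
  have tw : t * `|w| <= h * `|w| by rewrite ler_wpM2r.
  rewrite /K in hK; lra.
have [s [t [sh th E1]]] := @double_difference f x v w h (ltW h0)
  (fun s t sh th => let: conj Uy _ := rP _ (inball s t sh th) in conj (dv _ Uy) (dvw _ Uy)).
have inball' s' t' : 0 <= s' <= h -> 0 <= t' <= h -> ball x r (x + s' *: w + t' *: v).
  by move=> ? ?; rewrite addrAC; exact: inball.
have [s' [t' [sh' th' E2]]] := @double_difference f x w v h (ltW h0)
  (fun s t sh th => let: conj Uy _ := rP _ (inball' s t sh th) in conj (dw _ Uy) (dwv _ Uy)).
have [_ [near1 _]] := rP _ (inball s t sh th).
have [_ [_ near2]] := rP _ (inball' s' t' sh' th').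
rewrite [x + h *: w + h *: v]addrAC in E2.
move: near1 near2 E1 E2 => /=.
move: ('D_w ('D_v f) (x + _ + _)) ('D_v ('D_w f) (x + _ + _)) => z1 z2.
move: ('D_w ('D_v f) x) ('D_v ('D_w f) x) => a1 a2.
move: (f (x + h *: v + h *: w)) (f (x + h *: v)) (f (x + h *: w)) (f x) => f1 f2 f3 f4.
(* The two double differences coincide, so after division by [h * h] the intermediate mixed
   derivatives agree. Each limit value lies within [e / 2] of this common number. *)
move=> near1 near2 E1 E2; have z12 : z1 = z2.
  have hh0 : h * h != 0 by rewrite mulf_neq0 ?gt_eqF.
  by apply: (mulfI hh0); rewrite -E1 -E2 [f1 - f2 - f3]addrAC.
rewrite -z12 in near2.
by rewrite (splitr e) (le_trans (ler_distD z1 _ _))// lerD// ltW// distrC.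
Qed.

End DirectionalDerivatives.

(** * Calculus of second-order jets along one direction *)

Section Jets.
Context {R : realType} {V : normedModType R}.
Variables (U : set V) (a v : V).
Hypotheses (U_open : open U) (U_a : U a).
Implicit Types (f g : V -> R) (c d : R).

Lemma near_open (P : V -> Prop) x : U x -> (forall y, U y -> P y) ->
  \forall y \near x, P y.
Proof.
move=> Ux UP; apply: (@filterS _ _ (nbhs_filter x) U) => //.
exact: open_nbhs_nbhs.
Qed.

(* Taylor coefficients along the single direction v, so that no differentiability
   in several variables has to be tracked. *)
Definition jet2 f c0 c1 c2 : Prop :=
  [/\ f a = c0, forall x, U x -> derivable f x v, 'D_v f a = c1
    & is_derive a v ('D_v f) c2].

Lemma jet2_ext f g c0 c1 c2 : (forall x, U x -> f x = g x) ->
  jet2 f c0 c1 c2 -> jet2 g c0 c1 c2.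
Proof.
move=> fg [f0 df f1 f2].
have fgn x : U x -> \near x, f x = g x by move=> Ux; exact: near_open.
have D x : U x -> 'D_v f x = 'D_v g x by move=> Ux; exact: near_eq_derive (fgn x Ux).
split; first by rewrite -fg.
- by move=> x Ux; apply: near_eq_derivable (fgn x Ux) (df x Ux).
- by rewrite -D.
- by apply: near_eq_is_derive f2; exact: near_open.
Qed.

(** This is how equations between fields get differentiated: the jets of the two sides are computed
    separately and their coefficients compared. *)
Lemma jet2_unique f c0 c1 c2 d0 d1 d2 :
  jet2 f c0 c1 c2 -> jet2 f d0 d1 d2 -> [/\ c0 = d0, c1 = d1 & c2 = d2].
Proof. by move=> [<- _ <- [_ <-]] [<- _ <- [_ <-]]. Qed.

Lemma jet2_cst c : jet2 (cst c) c 0 0.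
Proof.
have D : 'D_v (cst c) = cst (0 : R) :> (V -> R) by apply/funext => x; rewrite derive_cst.
split=> [//|x _||]; rewrite ?D ?derive_cst//.
exact: is_derive_cst.
Qed.

Lemma jet2D f g c0 c1 c2 d0 d1 d2 : jet2 f c0 c1 c2 -> jet2 g d0 d1 d2 ->
  jet2 (fun x => f x + g x) (c0 + d0) (c1 + d1) (c2 + d2).
Proof.
move=> [f0 df f1 f2] [g0 dg g1 g2].
have D x : U x -> 'D_v (f + g) x = 'D_v f x + 'D_v g x.
  by move=> Ux; apply: deriveD; [exact: df|exact: dg].
split; first by rewrite f0 g0.
- by move=> x Ux; apply: derivableD; [exact: df|exact: dg].
- by rewrite -f1 -g1; exact: D.
- apply: (@near_eq_is_derive _ _ _ ('D_v f + 'D_v g)).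
  by apply: near_open => // x Ux; rewrite D.
Qed.

(** Leibniz rule to second order. The last entry of a jet is the plain second derivative, without
    the factor 1/2, whence the 2 in the cross term. *)
Lemma jet2M f g c0 c1 c2 d0 d1 d2 : jet2 f c0 c1 c2 -> jet2 g d0 d1 d2 ->
  jet2 (fun x => f x * g x) (c0 * d0) (c1 * d0 + c0 * d1)
    (c2 * d0 + 2 * c1 * d1 + c0 * d2).
Proof.
move=> [f0 df f1 f2] [g0 dg g1 g2].
have D x : U x -> 'D_v (f * g) x = f x * 'D_v g x + g x * 'D_v f x.
  by move=> Ux; apply: deriveM; [exact: df|exact: dg].
split; first by rewrite f0 g0.
- by move=> x Ux; apply: derivableM; [exact: df|exact: dg].
- by rewrite [LHS]D// f0 g0 f1 g1 addrC (mulrC d0).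
- apply: (@near_eq_is_derive _ _ _ (f * 'D_v g + g * 'D_v f)).
    by apply: near_open => // x Ux; rewrite D.
  have dfa := derivableP (df a U_a); have dga := derivableP (dg a U_a).
  rewrite f1 in dfa; rewrite g1 in dga.
  apply: is_derive_eq.
  rewrite f0 g0 f1 g1 /GRing.scale/=; ring.
Qed.

Lemma jet2N f c0 c1 c2 :
  jet2 f c0 c1 c2 -> jet2 (fun x => - f x) (- c0) (- c1) (- c2).
Proof.
move=> jf; have := jet2M (jet2_cst (-1)) jf.
rewrite !mul0r !mulr0 !mul0r !add0r !mulN1r.
by apply: jet2_ext => x _; rewrite mulN1r.
Qed.

Lemma jet2_sum n (f : 'I_n -> V -> R) (c0 c1 c2 : 'I_n -> R) :
  (forall i, jet2 (f i) (c0 i) (c1 i) (c2 i)) ->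
  jet2 (fun x => \sum_(i < n) f i x)
    (\sum_(i < n) c0 i) (\sum_(i < n) c1 i) (\sum_(i < n) c2 i).
Proof.
elim: n f c0 c1 c2 => [|n IH] f c0 c1 c2 jf.
  rewrite !big_ord0; apply: jet2_ext (jet2_cst 0) => x _; by rewrite big_ord0.
rewrite !big_ord_recl; apply: jet2_ext (jet2D (jf ord0)
  (IH _ _ _ _ (fun i => jf (lift ord0 i)))).
by move=> x _; rewrite big_ord_recl.
Qed.

(** The second derivative of the reciprocal is left existential: in the later products it always
    ends up multiplied by a quantity that vanishes at the origin. *)
Lemma jet2V f c0 c1 c2 : (forall x, U x -> f x != 0) -> jet2 f c0 c1 c2 ->
  exists d2, jet2 (fun x => (f x)^-1) c0^-1 (- c0 ^- 2 * c1) d2.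
Proof.
move=> fN0 [f0 df f1 f2].
have D x : U x -> 'D_v (fun y => (f y)^-1) x = - ((f x) ^+ 2)^-1 * 'D_v f x.
  by move=> Ux; apply: deriveV; [exact: fN0|exact: df].
have df2 : derivable (fun x => - ((f x) ^+ 2)^-1 * 'D_v f x) a v.
  apply: (@derivableM _ _ (fun x => - ((f x) ^+ 2)^-1)); last by case: f2.
  apply: (@derivableN _ _ _ (fun x => ((f x) ^+ 2)^-1)).
  apply: (@derivableV _ _ (fun x => (f x) ^+ 2)); first by rewrite expf_neq0// fN0.
  by apply: (@derivableM _ _ f f); exact: df.
exists ('D_v (fun x => - ((f x) ^+ 2)^-1 * 'D_v f x) a).
split; first by rewrite f0.
- by move=> x Ux; apply: derivableV; [exact: fN0|exact: df].
- by rewrite D// f0 f1.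
- apply: near_eq_is_derive (derivableP df2).
  by apply: near_open => // x Ux; rewrite D.
Qed.

End Jets.

(** * Partial derivatives of smooth fields and the effect of the rotational symmetry *)

Section Partials.
Context {R : realType}.
Variable U : set 'rV[R]_3.
Hypothesis U_open : open U.
Implicit Types (f : 'rV[R]_3 -> R) (x : 'rV[R]_3) (i j m : 'I_3).

Lemma smooth_derivable f i x : smooth U f -> U x -> derivable f x (delta_mx 0 i).
Proof. by move=> sf Ux; have [_ /(_ i)[+ _]] := sf 1%N; exact. Qed.

Lemma smooth_continuous f x : smooth U f -> U x -> {for x, continuous f}.
Proof. by move=> sf Ux; have [+ _] := sf 0%N; exact. Qed.

Lemma smooth_partial f i : smooth U f -> smooth U (partial i f).
Proof. by move=> sf k; have [_ /(_ i)[]] := sf k.+1. Qed.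

Lemma smooth_jet2 f m x : smooth U f -> U x ->
  jet2 U x (delta_mx 0 m) f (f x) (partial m f x) (partial m (partial m f) x).
Proof.
move=> sf Ux; split=> //; first by move=> y; exact: smooth_derivable.
by apply: derivableP; apply: smooth_derivable => //; exact: smooth_partial.
Qed.

Lemma smooth_partial_comm f i j x : smooth U f -> U x ->
  partial i (partial j f) x = partial j (partial i f) x.
Proof.
move=> sf Ux; apply: (@derive_comm _ _ U) => //.
- by move=> y; exact: smooth_derivable.
- by move=> y; exact: smooth_derivable.
- by move=> y; apply: smooth_derivable; exact: smooth_partial.
- by move=> y; apply: smooth_derivable; exact: smooth_partial.
- by apply: smooth_continuous => //; do 2 apply: smooth_partial.
- by apply: smooth_continuous => //; do 2 apply: smooth_partial.
Qed.

Lemma rot180_0 : rot180 (0 : 'rV[R]_3) = 0.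
Proof. by apply/rowP => k; rewrite !mxE oppr0 if_same. Qed.

Lemma rot180_line i (t : R) : i != ord_max ->
  rot180 (t *: delta_mx 0 i) = (- t) *: delta_mx 0 i.
Proof.
move=> iz; apply/rowP => k; rewrite !mxE eqxx /=.
have [->|kz] := eqVneq k ord_max; last by rewrite mulNr.
by rewrite eq_sym (negbTE iz) !mulr0.
Qed.

(** In the direction of z this is two-dimensionality. Along the x and y axes a scalar is even, so
    its derivative at the origin equals its own negative. *)
Lemma admissible_partial0 f i : U 0 -> admissible_scalar U f -> partial i f 0 = 0.
Proof.
move=> U0 [sf f2d fsym].
have [->|iz] := eqVneq i ord_max; first exact: f2d.
pose e : 'rV[R]_3 := delta_mx 0 i.
have dl := @is_derive_line _ _ f 0 e 0.
rewrite scale0r addr0 in dl; have {}dl := dl (smooth_derivable sf U0).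
have dr : is_derive (0 : R) 1 ((fun s : R => f (0 + s *: e)) \o -%R) ('D_e f 0 * -1).
  by apply: is_derive1_comp; rewrite oppr0.
have cl : {for (0 : R), continuous (fun s : R => s *: e)} by exact: scalel_continuous.
(* [U] need not be invariant under the rotation, so evenness is available only for small [s], where
   both [s *: e] and its opposite lie in [U]. *)
have near0 : \forall s \near (0 : R), U (s *: e).
  by apply: cl; rewrite scale0r; exact: open_nbhs_nbhs.
have near0N : \forall s \near (0 : R), U (- s *: e).
  have : {for (0 : R), continuous (fun s : R => - s *: e)}.
    by move=> ?; apply: cvgZr_tmp; exact: opp_continuous.
  by apply; rewrite oppr0 scale0r; exact: open_nbhs_nbhs.
have E : \forall s \near (0 : R),
    ((fun s : R => f (0 + s *: e)) \o -%R) s = (fun s : R => f (0 + s *: e)) s.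
  near=> s; rewrite /= !add0r.
  have Us : U (s *: e) by near: s.
  have UNs : U (- s *: e) by near: s.
  by have := fsym _ Us; rewrite rot180_line// => /(_ UNs) ->; rewrite mul1r.
have [_ dl'] := near_eq_is_derive E dr.
move: dl'; rewrite (derive_val (is_derive := dl)) /partial -/e.
lra.
Unshelve. all: by end_near. Qed.

(** On [U] the entropy is 3/2 ln T - ln n, by positivity of [n] and [T]. *)
Lemma partial_entropy n T i x : admissible_scalar U n -> admissible_scalar U T ->
  (forall y, U y -> 0 < n y) -> (forall y, U y -> 0 < T y) -> U x ->
  partial i (entropy n T) x = 3 / 2 * (partial i T x * (T x)^-1) - partial i n x * (n x)^-1.
Proof.
move=> [sn _ _] [sT _ _] n0 T0 Ux.
have dT : is_derive x (delta_mx 0 i) (@ln R \o T) ((T x)^-1 * partial i T x).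
  apply: is_derive_comp; first exact: is_derive1_ln (T0 x Ux).
  exact/derivableP/smooth_derivable.
have dn : is_derive x (delta_mx 0 i) (@ln R \o n) ((n x)^-1 * partial i n x).
  apply: is_derive_comp; first exact: is_derive1_ln (n0 x Ux).
  exact/derivableP/smooth_derivable.
have E : \near x, ((3 / 2) *: (@ln R \o T) - (@ln R \o n)) x = entropy n T x.
  apply: (near_open U_open) => // y Uy; rewrite /entropy ln_div ?ln_powR //.
    by rewrite posrE powR_gt0 // T0.
  by rewrite posrE n0.
rewrite /partial -(near_eq_derive _ E) derive_val /GRing.scale/=.
by rewrite (mulrC (T x)^-1) (mulrC (n x)^-1).
Qed.

End Partials.

(** * Algebra of second- and fourth-order tensors *)

Section TensorAlgebra.
Context {R : realType}.
Implicit Types (A B : 'M[R]_3) (mu : tensor4 R).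

Lemma ddot1r A : ddot A 1%:M = \tr A.
Proof.
apply: eq_bigr => i _; rewrite (bigD1 i)//= mxE eqxx mulr1 big1 ?addr0// => j ji.
by rewrite mxE eq_sym (negbTE ji) mulr0.
Qed.

Lemma ddotDr A B C : ddot A (B + C) = ddot A B + ddot A C.
Proof.
rewrite /ddot -big_split; apply: eq_bigr => i _; rewrite -big_split.
by apply: eq_bigr => j _; rewrite mxE mulrDr.
Qed.

Lemma ddotZr (c : R) A B : ddot A (c *: B) = c * ddot A B.
Proof.
rewrite /ddot mulr_sumr; apply: eq_bigr => i _; rewrite mulr_sumr.
by apply: eq_bigr => j _; rewrite mxE mulrCA.
Qed.

Lemma ddot_contract4 mu A : ddot A (contract4 mu A) = quad4 mu A.
Proof.
apply: eq_bigr => i _; apply: eq_bigr => j _; rewrite mxE mulr_sumr.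
apply: eq_bigr => k _; rewrite mulr_sumr; apply: eq_bigr => l _.
by rewrite mulrA.
Qed.

Lemma contract4_0 mu : contract4 mu 0 = 0.
Proof.
apply/matrixP => i j; rewrite !mxE big1// => k _; rewrite big1// => l _.
by rewrite mxE mulr0.
Qed.

Lemma quad4_0 mu : quad4 mu 0 = 0.
Proof. by rewrite -ddot_contract4 contract4_0 -(scale0r 0) ddotZr mul0r. Qed.

Lemma dev_strain_sym_traceless (u : 'rV[R]_3 -> 'rV[R]_3) x :
  sym_traceless (dev_strain u x).
Proof.
split.
  by rewrite /dev_strain /sym_part linearB linearZ linearD /= trmxK addrC tr_scalar_mx
    [X in 2^-1 *: X]addrC addrC.
rewrite /dev_strain /sym_part linearB linearZ linearD /= mxtrace_tr mxtrace_scalar.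
have -> : \tr (grad_vec u x) = div_vec u x by apply: eq_bigr => i _; rewrite mxE.
by rewrite -mulr_natl; field.
Qed.

(** Exchanging the two indices turns the sum into its negative. *)
Lemma skew_sym_sum (A H : 'I_3 -> 'I_3 -> R) :
  (forall i j, A i j + A j i = 0) -> (forall i j, H i j = H j i) ->
  \sum_(i < 3) \sum_(j < 3) A i j * H i j = 0.
Proof.
move=> skewA symH; set S := LHS.
have : S = - S.
  rewrite {1}/S exchange_big /= /S -sumrN; apply: eq_bigr => i _.
  rewrite -sumrN; apply: eq_bigr => j _.
  have /eqP := skewA j i; rewrite addr_eq0 => /eqP ->; by rewrite symH mulNr.
lra.
Qed.

End TensorAlgebra.

(** * Jets at the origin of the terms of the entropy equation *)

Section SteadyState.
Context {R : realType}.
Variable U : set 'rV[R]_3.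
Hypotheses (U_open : open U) (U_origin : U 0).
Implicit Types (f n T : 'rV[R]_3 -> R) (u : 'rV[R]_3 -> 'rV[R]_3) (i j m : 'I_3).

Local Notation jet m := (jet2 U 0 (delta_mx 0 m)).

(** Once some jet is known from the calculus rules, its coefficients may be renamed as the iterated
    partial derivatives. *)
Lemma jet2_partial m f c0 c1 c2 : jet m f c0 c1 c2 ->
  jet m f (f 0) (partial m f 0) (partial m (partial m f) 0).
Proof. by move=> [_ df _ [d2 _]]; split=> //; exact: derivableP. Qed.

Lemma jet2_inv m f : (forall x, U x -> 0 < f x) -> admissible_scalar U f ->
  exists c, jet m (fun x => (f x)^-1) (f 0)^-1 0 c.
Proof.
move=> f0 af; have [sf _ _] := af.
have fN0 x : U x -> f x != 0 by move=> /f0; exact: lt0r_neq0.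
have [c] := jet2V U_open U_origin fN0 (smooth_jet2 m sf U_origin).
by rewrite (admissible_partial0 U_open _ U_origin af) mulr0; exists c.
Qed.

(* The Hessian of the entropy at the origin, where n and T have zero gradient. *)
Definition entropy_hess n T m i : R :=
  3 / 2 * (partial m (partial i T) 0 * (T 0)^-1) - partial m (partial i n) 0 * (n 0)^-1.

(** The factor [partial i f] vanishes at the origin, so only the term differentiating it survives at
    first order. *)
Lemma jet2_log_gradient m i f : (forall x, U x -> 0 < f x) -> admissible_scalar U f ->
  exists c, jet m (fun x => partial i f x * (f x)^-1)
    0 (partial m (partial i f) 0 * (f 0)^-1) c.
Proof.
move=> f0 af; have [sf _ _] := af; have [c jV] := jet2_inv m f0 af.
have jP := smooth_jet2 m (smooth_partial i sf) U_origin.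
rewrite (admissible_partial0 U_open i U_origin af) in jP.
have := jet2M U_open U_origin jP jV.
by rewrite mul0r mulr0 addr0; eexists; eassumption.
Qed.

Lemma jet2_entropy_gradient m i n T :
  admissible_scalar U n -> admissible_scalar U T ->
  (forall x, U x -> 0 < n x) -> (forall x, U x -> 0 < T x) ->
  exists c, jet m (partial i (entropy n T)) 0 (entropy_hess n T m i) c.
Proof.
move=> an aT n0 T0.
have [cT jT] := jet2_log_gradient m i T0 aT.
have [cn jn] := jet2_log_gradient m i n0 an.
have jT' := jet2M U_open U_origin (jet2_cst U 0 (delta_mx 0 m) (3 / 2)) jT.
have := jet2D U_open U_origin jT' (jet2N U_open U_origin jn).
rewrite !mulr0 mul0r oppr0 addr0 add0r => jTn; eexists.
apply: jet2_ext jTn => // x Ux.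
by rewrite (partial_entropy U_open).
Qed.

(** Both factors, or one of them identically, vanish at the origin, so the second derivative reduces
    to the Leibniz cross term. *)
Lemma jet2_entropy_transport m i n T u :
  admissible_scalar U n -> admissible_scalar U T -> admissible_vector U u ->
  (forall x, U x -> 0 < n x) -> (forall x, U x -> 0 < T x) ->
  jet m (fun x => u x 0 i * partial i (entropy n T) x)
    0 0 (2 * partial m (fun x => u x 0 i) 0 * entropy_hess n T m i).
Proof.
move=> an aT au n0 T0; have [su _ usym] := au i.
have [c jS] := jet2_entropy_gradient m i an aT n0 T0.
have ju := smooth_jet2 m su U_origin.
(* The z component of [u] is even and may be nonzero at the origin; there the z derivative of the
   entropy vanishes on all of [U] instead, and with it [entropy_hess n T m i]. The other components
   of [u] are odd. *)
have [iz|iz] := eqVneq i ord_max.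
  have jS0 : jet m (partial i (entropy n T)) 0 0 0.
    apply: jet2_ext (jet2_cst U 0 (delta_mx 0 m) 0) => // x Ux.
    rewrite iz (partial_entropy U_open)//.
    have [_ -> // _] := an; have [_ -> // _] := aT.
    by rewrite !mul0r mulr0 subr0.
  have [_ -> _] := jet2_unique jS jS0.
  by have := jet2M U_open U_origin ju jS0; rewrite !mulr0 !addr0.
have u0 : u 0 0 i = 0.
  have := usym 0 U_origin; rewrite rot180_0 /= iz => /(_ U_origin); lra.
have := jet2M U_open U_origin ju jS.
by rewrite u0 !mulr0 !mul0r !addr0 add0r.
Qed.

Lemma jet2_div_vec m u : (forall i, smooth U (fun x => u x 0 i)) ->
  jet m (div_vec u) (div_vec u 0) (partial m (div_vec u) 0)
    (partial m (partial m (div_vec u)) 0).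
Proof.
move=> su; apply: jet2_partial; apply: (jet2_sum U_open U_origin) => i.
exact: smooth_jet2 (smooth_partial i (su i)) U_origin.
Qed.

Lemma jet2_dev_strain m i j u : (forall i, smooth U (fun x => u x 0 i)) ->
  let e := fun x => dev_strain u x i j in
  jet m e (e 0) (partial m e 0) (partial m (partial m e) 0).
Proof.
move=> su e.
have jS k l := smooth_jet2 m (smooth_partial k (su l)) U_origin.
have jc c := jet2_cst U 0 (delta_mx 0 m) c.
have jsym := jet2M U_open U_origin (jc 2^-1) (jet2D U_open U_origin (jS i j) (jS j i)).
have jdiv := jet2M U_open U_origin (jc (- (3^-1 * (i == j)%:R))) (jet2_div_vec m su).
apply: jet2_partial; apply: jet2_ext (jet2D U_open U_origin jsym jdiv) => // x _.
by rewrite /e /dev_strain /sym_part !mxE mulNr mulrAC mulr_natr.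
Qed.

(** Both tensors vanish at the origin, which leaves only the cross term of the product rule. *)
Lemma jet2_ddot m (A B : 'rV[R]_3 -> 'M[R]_3) (a1 b1 : 'M[R]_3) :
  (forall i j, exists c, jet m (fun x => A x i j) 0 (a1 i j) c) ->
  (forall i j, exists c, jet m (fun x => B x i j) 0 (b1 i j) c) ->
  jet m (fun x => ddot (A x) (B x)) 0 0 (2 * ddot a1 b1).
Proof.
move=> jA jB.
have jAB i j : jet m (fun x => A x i j * B x i j) 0 0 (2 * (a1 i j * b1 i j)).
  have [c jAij] := jA i j; have [d jBij] := jB i j.
  by have := jet2M U_open U_origin jAij jBij; rewrite !mulr0 !mul0r !addr0 add0r mulrA.
have := jet2_sum U_open U_origin (fun i => jet2_sum U_open U_origin (jAB i)).
have sum0 : \sum_(i < 3) \sum_(j < 3) (0 : R) = 0 by rewrite big1// => i _; rewrite big1.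
rewrite sum0 /ddot mulr_sumr.
by under eq_bigr => i _ do rewrite -mulr_sumr.
Qed.

End SteadyState.

(** * The corollary: expansion of the closure and of the entropy equation at the origin *)

Unset Implicit Arguments.

Theorem corollary1 (R : realType) (U : set 'rV[R]_3)
  (n T err tau : 'rV[R]_3 -> R) (u q B : 'rV[R]_3 -> 'rV[R]_3)
  (dev : 'rV[R]_3 -> 'M[R]_3) (mu : 'rV[R]_3 -> tensor4 R)
  (U_open : open U) (U_origin : U 0)
  (n_adm : admissible_scalar U n)
  (T_adm : admissible_scalar U T)
  (err_adm : admissible_scalar U err)
  (tau_adm : admissible_scalar U tau)
  (u_adm : admissible_vector U u)
  (q_adm : admissible_vector U q)
  (B_adm : admissible_vector U B)
  (dev_adm : admissible_tensor2 U dev)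
  (mu_adm : admissible_tensor4 U mu)
  (n_gt0 : forall x, U x -> 0 < n x)
  (T_gt0 : forall x, U x -> 0 < T x)
  (tau_gt0 : forall x, U x -> 0 < tau x)
  (dev_sym : forall x, U x -> sym_traceless (dev x))
  (mu_sym : forall x, U x -> forall A : 'M[R]_3,
     sym_traceless A -> sym_traceless (contract4 (mu x) A))
  (mu_gyro : forall x, U x -> gyrotropic (B x) (mu x))
  (mu_pos : forall x, U x -> forall A : 'M[R]_3,
     sym_traceless A -> A <> 0 -> 0 < quad4 (mu x) A)
  (mass : forall x, U x -> div_vec (fun y => n y *: u y) x = 0)
  (entropy_evolution : forall x, U x ->
     dot (u x) (grad (entropy n T) x) =
       - ddot (dev_strain u x) (1%:M + dev x)
       - (pressure n T x)^-1 * div_vec q x + err x)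
  (closure : forall x, U x ->
     - dev x = (2 * tau x) *: contract4 (mu x) (dev_strain u x))
  (divq_origin : div_vec q 0 = 0)
  (lap_divq_origin : laplacian (div_vec q) 0 = 0)
  (err_origin : err 0 = 0)
  (grad_err_origin : grad err 0 = 0)
  (hess_err_origin : hess err 0 = 0) :
  div_tensor (pressure_tensor n T dev) 0 = 0.
Proof.
have su i : smooth U (fun x => u x 0 i) by have [] := u_adm i.
have sq i : smooth U (fun x => q x 0 i) by have [] := q_adm i.
have sdev i j : smooth U (fun x => dev x i j) by have [] := dev_adm i j.
have smu i j k l : smooth U (fun x => mu x i j k l) by have [] := mu_adm i j k l.
have [sn _ _] := n_adm; have [sT _ _] := T_adm.
have [stau _ _] := tau_adm; have [serr _ _] := err_adm.
pose e := dev_strain u.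
have eST x : sym_traceless (e x) by exact: dev_strain_sym_traceless.
have ddot_e x : ddot (e x) (1%:M + dev x) = ddot (e x) (dev x).
  by rewrite ddotDr ddot1r (eST x).2 add0r.
have closure' x : U x -> dev x = (- (2 * tau x)) *: contract4 (mu x) (e x).
  by move=> /closure E; rewrite scaleNr -E opprK.
(* Otherwise positivity of [mu] makes the right-hand side of the entropy equation, 2 tau e : mu : e,
   positive, while the left-hand side is zero because the entropy gradient vanishes. *)
have e0 : e 0 = 0.
  apply: contrapT => eN0.
  have := entropy_evolution 0 U_origin.
  rewrite ddot_e closure'// ddotZr ddot_contract4 divq_origin mulr0 subr0 err_origin addr0.
  rewrite /dot big1 => [|i _]; last first.
    rewrite mxE (partial_entropy U_open)//.
    by rewrite !(admissible_partial0 U_open _ U_origin)// !mul0r mulr0 subr0 mulr0.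
  rewrite mulNr opprK => /esym/eqP; apply/negP; rewrite gt_eqF// mulr_gt0//.
    by rewrite mulr_gt0// tau_gt0.
  exact: mu_pos.
have dev0 : dev 0 = 0 by rewrite closure'// e0 contract4_0 scaler0.
(* As the gradient of [n] vanishes at the origin, mass conservation there reads n div u = 0. *)
have divu0 : div_vec u 0 = 0.
  have := mass 0 U_origin; rewrite /div_vec.
  have E i : partial i (fun y => (n y *: u y) 0 i) 0 = n 0 * partial i (fun y => u y 0 i) 0.
    have := jet2M U_open U_origin (smooth_jet2 i sn U_origin) (smooth_jet2 i (su i) U_origin).
    rewrite (admissible_partial0 U_open _ U_origin n_adm) mul0r add0r => -[_ _ <- _].
    by congr (partial i _ 0); apply/funext => y; rewrite mxE.
  under eq_bigr => i _ do rewrite E.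
  by rewrite -mulr_sumr => /eqP; rewrite mulf_eq0 gt_eqF ?n_gt0//= => /eqP.
have skew m i : partial m (fun y => u y 0 i) 0 + partial i (fun y => u y 0 m) 0 = 0.
  have := congr1 (fun A : 'M[R]_3 => A m i) e0.
  rewrite /e /dev_strain divu0 mulr0 /sym_part !mxE mul0rn subr0 => /eqP.
  by rewrite mulf_eq0 invr_eq0 pnatr_eq0 => /eqP.
pose de m : 'M[R]_3 := \matrix_(i, j) partial m (fun y => e y i j) 0.
pose ddev m : 'M[R]_3 := \matrix_(i, j) partial m (fun y => dev y i j) 0.
have je m i j : exists c, jet2 U 0 (delta_mx 0 m) (fun y => e y i j) 0 (de m i j) c.
  eexists; have /= := jet2_dev_strain U_open U_origin m i j su.
  rewrite -/e e0 !mxE; exact.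
have jdev m i j : exists c, jet2 U 0 (delta_mx 0 m) (fun y => dev y i j) 0 (ddev m i j) c.
  eexists; have := smooth_jet2 m (sdev i j) U_origin.
  rewrite dev0 !mxE; exact.
(* Symmetry and vanishing trace survive differentiation, so [mu_pos] will apply to [de m]. *)
have deST m : sym_traceless (de m).
  split.
    apply/matrixP => i j; rewrite !mxE; congr (partial m _ 0).
    by apply/funext => y; rewrite -{1}(eST y).1 mxE.
  have jsum := jet2_sum U_open U_origin (fun i => svalP (cid (je m i i))).
  have jtr : jet2 U 0 (delta_mx 0 m) (fun y => \tr (e y)) 0 0 0.
    apply: jet2_ext (jet2_cst U 0 (delta_mx 0 m) 0) => // y _.
    by rewrite (eST y).2.
  by have [_ + _] := jet2_unique jsum jtr.
(* The closure differentiated once: since [e 0 = 0], the terms with derivatives of [tau] and [mu]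
   drop out. *)
have ddevE m : ddev m = (- (2 * tau 0)) *: contract4 (mu 0) (de m).
  apply/matrixP => i j.
  have jmu k l := jet2M U_open U_origin (smooth_jet2 m (smu i j k l) U_origin)
    (svalP (cid (je m k l))).
  have jcon := jet2_sum U_open U_origin (fun k => jet2_sum U_open U_origin (jmu k)).
  have jt := jet2M U_open U_origin (jet2_cst U 0 (delta_mx 0 m) (-2))
    (smooth_jet2 m stau U_origin).
  have jR := jet2M U_open U_origin jt jcon.
  have [c jL] := jdev m i j.
  have jL' : jet2 U 0 (delta_mx 0 m) (fun x => (cst (- 2) x * tau x) *
      (\sum_(k < 3) \sum_(l < 3) mu x i j k l * e x k l)) 0 (ddev m i j) c.
    apply: jet2_ext jL => // x Ux.
    by rewrite closure'// !mxE /= mulNr.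
  have [_ <- _] := jet2_unique jR jL'.
  rewrite [in RHS]mxE [contract4 _ _ _ _]mxE.
  rewrite [X in _ * X + _]big1 ?mulr0 ?add0r; last first.
    by move=> k _; rewrite big1// => l _; rewrite mulr0.
  rewrite mulNr; congr (_ * _); apply: eq_bigr => k _; apply: eq_bigr => l _.
  by rewrite mulr0 add0r.
(* The second derivative along [m] of both sides of the entropy equation. The factor 4 combines the
   2 of the Leibniz cross term with the 2 of the closure. *)
have second m :
    \sum_(i < 3) 2 * partial m (fun x => u x 0 i) 0 * entropy_hess n T m i =
    4 * tau 0 * quad4 (mu 0) (de m)
    - (pressure n T 0)^-1 * partial m (partial m (div_vec q)) 0.
  have jL := jet2_sum U_open U_origin (fun i => jet2_entropy_transport U_open U_origin m i
    n_adm T_adm u_adm n_gt0 T_gt0).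
  have jdd := jet2N U_open U_origin (jet2_ddot U_open U_origin (je m) (jdev m)).
  have [cn jn] := jet2_inv U_open U_origin m n_gt0 n_adm.
  have [cT jT] := jet2_inv U_open U_origin m T_gt0 T_adm.
  have jp := jet2M U_open U_origin jn jT.
  have jq := jet2N U_open U_origin (jet2M U_open U_origin jp
    (jet2_div_vec U_open U_origin m sq)).
  have jerr := smooth_jet2 m serr U_origin.
  have jR := jet2D U_open U_origin (jet2D U_open U_origin jdd jq) jerr.
  have jL' := jet2_ext (g := fun x => (- ddot (e x) (dev x) +
    - ((n x)^-1 * (T x)^-1 * div_vec q x)) + err x) U_open U_origin _ jL.
  have [|_ _ ->] := jet2_unique (jL' _) jR.
    move=> x Ux; rewrite -ddot_e -invfM -(entropy_evolution x Ux).
    by apply: eq_bigr => i _; rewrite mxE.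
  have -> : partial m (partial m err) 0 = 0.
    by have := congr1 (fun A : 'M[R]_3 => A m m) hess_err_origin; rewrite !mxE.
  rewrite ddevE ddotZr ddot_contract4 divq_origin invfM; ring.
have symH m i : entropy_hess n T m i = entropy_hess n T i m.
  by rewrite /entropy_hess !(smooth_partial_comm U_open m i).
have quad_sum : \sum_(m < 3) quad4 (mu 0) (de m) = 0.
  have := eq_bigr _ (fun m (_ : true) => second m).
  move=> /(_ 0 +%R (index_enum 'I_3)).
  (* The velocity gradient is skew by [skew], the entropy Hessian symmetric by [symH]. *)
  have -> : \sum_(m < 3) \sum_(i < 3)
      2 * partial m (fun x => u x 0 i) 0 * entropy_hess n T m i = 0.
    by apply: skew_sym_sum => // m i; rewrite -mulrDr skew mulr0.
  rewrite sumrB -!mulr_sumr -/(laplacian (div_vec q) 0) lap_divq_origin mulr0 subr0.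
  by move=> /esym/eqP; rewrite mulf_eq0 gt_eqF ?mulr_gt0 ?tau_gt0//= => /eqP.
have quad_ge0 m : 0 <= quad4 (mu 0) (de m).
  have [->|deN0] := eqVneq (de m) 0; first by rewrite quad4_0.
  by apply: ltW; apply: mu_pos => //; exact/eqP.
(* Nonnegative terms with sum zero vanish one by one, and definiteness of [mu 0] then forces [de m]
   to be zero. *)
have de0 m : de m = 0.
  have [//|deN0] := eqVneq (de m) 0.
  have := psumr_eq0P (fun m _ => quad_ge0 m) quad_sum.
  by move=> /(_ m isT)/eqP; rewrite gt_eqF// mu_pos//; exact/eqP.
apply/rowP => j; rewrite !mxE big1 // => i _.
(* The pressure has zero gradient at the origin, so differentiating p (I + dev) leaves only p times
   the derivative of [dev], which is zero by [ddevE] and [de0]. *)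
have jp := jet2M U_open U_origin (smooth_jet2 i sn U_origin) (smooth_jet2 i sT U_origin).
rewrite (admissible_partial0 U_open _ U_origin n_adm) in jp.
rewrite (admissible_partial0 U_open _ U_origin T_adm) mul0r mulr0 addr0 in jp.
have [c jd] := jdev i i j.
have jD := jet2D U_open U_origin (jet2_cst U 0 (delta_mx 0 i) ((1%:M : 'M[R]_3) i j)) jd.
have := jet2M U_open U_origin jp jD.
have -> : ddev i i j = 0 by rewrite ddevE de0 contract4_0 scaler0 mxE.
rewrite mul0r !addr0 => -[_ _ + _]; rewrite mulr0 addr0; apply: etrans.
by congr (partial i _ 0); apply/funext => y; rewrite !mxE.
Qed.
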